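(* For each of the following sets $P$ of generalized patterns, $|S_n(P)|=2^{n-1}$ for every $n\ge1$: $\{1\text{-}23,12\text{-}3,2\text{-}13,21\text{-}3\}$, $\{31\text{-}2,3\text{-}12,13\text{-}2,1\text{-}32\}$, $\{2\text{-}13,21\text{-}3,13\text{-}2,1\text{-}32\}$, $\{2\text{-}31,23\text{-}1,1\text{-}32,13\text{-}2\}$.
   Context: $S_n$ is the set of permutations $\pi=\pi_1\pi_2\cdots\pi_n$ of $\{1,\dots,n\}$. For $abc$ a permutation of $123$, the generalized pattern $a\text{-}bc$ is contained in $\pi$ if there are indices $i<j$ with $j+1\le n$ such that $\pi_i\pi_j\pi_{j+1}$ is order-isomorphic to $abc$; the generalized pattern $ab\text{-}c$ is contained in $\pi$ if there are indices $i,k$ with $i+1<k\le n$ such that $\pi_i\pi_{i+1}\pi_k$ is order-isomorphic to $abc$. (Letters not separated by a dash must occur in adjacent positions; letters separated by a dash need not be adjacent.) $\pi$ avoids a pattern if it does not contain it. For a set $P$ of generalized patterns, $S_n(P)$ is the set of $\pi\in S_n$ avoiding every pattern in $P$. *)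

(* Defs.v *)
From mathcomp Require Import all_boot all_fingroup.

Set Implicit Arguments.
Unset Strict Implicit.
Unset Printing Implicit Defensive.

(* [Dash1 a b c] is the generalized pattern a-bc and [Dash2 a b c] is ab-c,
   for [:: a; b; c] a permutation of [:: 1; 2; 3]. *)
Inductive gpattern :=
  | Dash1 of nat & nat & nat
  | Dash2 of nat & nat & nat.

Definition order_isomorphic (s t : seq nat) : bool :=
  (size s == size t) &&
  [forall i : 'I_(size s), forall j : 'I_(size s),
     (nth 0 s i < nth 0 s j) == (nth 0 t i < nth 0 t j)].

(* Positions and values of pi : 'S_n are numbered 0, ..., n-1 rather than
   1, ..., n; only their relative order and adjacency matter here. *)
Definition contains (n : nat) (pi : 'S_n) (p : gpattern) : bool :=
  match p with
  | Dash1 a b c =>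
      [exists i : 'I_n, exists j : 'I_n, exists k : 'I_n,
        [&& i < j, k == j.+1 :> nat &
            order_isomorphic [:: val (pi i); val (pi j); val (pi k)]
                             [:: a; b; c]]]
  | Dash2 a b c =>
      [exists i : 'I_n, exists j : 'I_n, exists k : 'I_n,
        [&& j == i.+1 :> nat, j < k &
            order_isomorphic [:: val (pi i); val (pi j); val (pi k)]
                             [:: a; b; c]]]
  end.

Definition avoids (n : nat) (pi : 'S_n) (p : gpattern) : bool :=
  ~~ contains pi p.

Definition avoiders (n : nat) (P : seq gpattern) : {set 'S_n} :=
  [set pi : 'S_n | all (avoids pi) P].

(* Main.v *)
Require Import Defs.
From mathcomp Require Import all_boot all_fingroup.
From mathcomp Require Import zify.

(** A crossing argument (between a position with value below a level and one
    above it, two adjacent positions straddle the level) turns each set of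
    dashed patterns into the set of underlying classical patterns, i.e. into a
    condition on all triples of positions.  For the first three sets, a
    permutation of size n+1 is a permutation of size n together with a last
    value, and every avoider extends by exactly two last values.  The fourth
    set is the image of the second one under inversion. *)

(** * Classical patterns as conditions on triples of values *)

Definition avoids3 (R : nat -> nat -> nat -> bool) {n : nat} (pi : 'S_n) : bool :=
  [forall i : 'I_n, forall j : 'I_n, forall k : 'I_n,
     (i < j < k) ==> ~~ R (pi i) (pi j) (pi k)].

Lemma avoids3P (R : nat -> nat -> nat -> bool) (n : nat) (pi : 'S_n) :
  reflect (forall i j k : 'I_n, i < j -> j < k -> ~~ R (pi i) (pi j) (pi k))
          (avoids3 R pi).
Proof.
apply: (iffP idP) => [H i j k ij jk | H].
  by move/forallP/(_ i)/forallP/(_ j)/forallP/(_ k)/implyP: H; apply; rewrite ij jk.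
apply/forallP => i; apply/forallP => j; apply/forallP => k.
by apply/implyP => /andP[]; apply: H.
Qed.

(** On distinct values, this relation and the next three are unions of two classical patterns: 123
    or 213, 132 or 312, 213 or 132, and 132 or 231. *)
Definition last_below_two (a b c : nat) := (a < c) && (b < c).
Definition last_between (a b c : nat) := (a < c < b) || (b < c < a).
Definition is_213_or_132 (a b c : nat) := (b < a < c) || (a < c < b).
Definition is_peak (a b c : nat) := (a < b) && (c < b).

(** Each comparison is kept in both directions because the entries are not assumed distinct: two
    false comparisons encode equality. *)
Lemma order_isomorphic3 (x y z a b c : nat) :
  order_isomorphic [:: x; y; z] [:: a; b; c] =
  [&& (x < y) == (a < b), (y < x) == (b < a), (x < z) == (a < c),
      (z < x) == (c < a), (y < z) == (b < c) & (z < y) == (c < b)].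
Proof.
rewrite /order_isomorphic /=; apply/forallP/idP => [H | H i].
  have E (u v : 'I_3) := eqP (forallP (H u) v).
  have /= E01 := E (inord 0) (inord 1); have /= E10 := E (inord 1) (inord 0).
  have /= E02 := E (inord 0) (inord 2); have /= E20 := E (inord 2) (inord 0).
  have /= E12 := E (inord 1) (inord 2); have /= E21 := E (inord 2) (inord 1).
  rewrite !inordK //= in E01 E10 E02 E20 E12 E21.
  by rewrite E01 E10 E02 E20 E12 E21 !eqxx.
case/and5P: H => /eqP E01 /eqP E10 /eqP E02 /eqP E20 /andP[/eqP E12 /eqP E21].
apply/forallP => j; case: i j => [[|[|[|i]]] hi] [[|[|[|j]]] hj] //=;
  by rewrite ?ltnn ?E01 ?E10 ?E02 ?E20 ?E12 ?E21.
Qed.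

Ltac solve_order_isomorphic x y z :=
  rewrite order_isomorphic3 /=;
  case: (ltngtP x y) => ?; case: (ltngtP x z) => ?; case: (ltngtP y z) => ? //=; lia.

Lemma order_isomorphic_123 (x y z : nat) :
  order_isomorphic [:: x; y; z] [:: 1; 2; 3] = (x < y < z).
Proof. solve_order_isomorphic x y z. Qed.

Lemma order_isomorphic_132 (x y z : nat) :
  order_isomorphic [:: x; y; z] [:: 1; 3; 2] = (x < z < y).
Proof. solve_order_isomorphic x y z. Qed.

Lemma order_isomorphic_213 (x y z : nat) :
  order_isomorphic [:: x; y; z] [:: 2; 1; 3] = (y < x < z).
Proof. solve_order_isomorphic x y z. Qed.

Lemma order_isomorphic_231 (x y z : nat) :
  order_isomorphic [:: x; y; z] [:: 2; 3; 1] = (z < x < y).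
Proof. solve_order_isomorphic x y z. Qed.

Lemma order_isomorphic_312 (x y z : nat) :
  order_isomorphic [:: x; y; z] [:: 3; 1; 2] = (y < z < x).
Proof. solve_order_isomorphic x y z. Qed.

Definition order_isomorphicE :=
  (order_isomorphic_123, order_isomorphic_132, order_isomorphic_213,
   order_isomorphic_231, order_isomorphic_312).

(** * Crossing a level at adjacent positions *)

(** A discrete intermediate value argument, by induction on [k - j]: either [Q] holds at [k - 1],
    and the last two positions serve, or [k - 1] replaces [k]. *)
Lemma ord_crossing (n : nat) (Q : pred 'I_n) (j k : 'I_n) :
  j <= k -> Q j -> ~~ Q k ->
  exists p q : 'I_n, [/\ q = p.+1 :> nat, j <= p, q <= k, Q p & ~~ Q q].
Proof.
move=> jk Qj; have [m] := ubnP (k - j); elim: m k jk => // m IH k jk lt_m Qk.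
have lt_jk : j < k.
  rewrite ltn_neqAle jk andbT; apply: contraNneq Qk => /val_inj <-.
  exact: Qj.
have lt_k' : k.-1 < n by have := ltn_ord k; lia.
case: (boolP (Q (Ordinal lt_k'))) => Qk'.
  by exists (Ordinal lt_k'), k; split=> //=; lia.
have [||p [q [qE jp qk Qp Qq]]] := IH (Ordinal lt_k') _ _ Qk' => /=; try lia.
by exists p, q; split=> //; rewrite /= in qk; lia.
Qed.

(** The last clause also records that the adjacent pair crosses [v] in the same direction as the
    pair [j], [k]. *)
Lemma perm_crossing (n : nat) (pi : 'S_n) (v : nat) (j k : 'I_n) :
  j < k -> (pi j < v <= pi k) || (pi k < v <= pi j) ->
  exists p q : 'I_n, [/\ q = p.+1 :> nat, j <= p, q <= k &
    (pi j < v) && (pi p < v <= pi q) || (v <= pi j) && (pi q < v <= pi p)].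
Proof.
move=> jk /orP[]/andP[H1 H2].
  have [|||p [q [qE jp qk Qp Qq]]] := @ord_crossing n (fun x => pi x < v) j k; try lia.
  by exists p, q; split=> //; lia.
have [|||p [q [qE jp qk Qp Qq]]] := @ord_crossing n (fun x => v <= pi x) j k; try lia.
by exists p, q; split=> //; lia.
Qed.

Lemma perm_val_neq (n : nat) (pi : 'S_n) (i j : 'I_n) :
  i < j -> val (pi i) <> val (pi j).
Proof. by move=> ij /val_inj/perm_inj E; rewrite E ltnn in ij. Qed.

(** * From dashed patterns to classical ones *)

Lemma avoids_Dash1P (n : nat) (pi : 'S_n) (a b c : nat) :
  reflect (forall i j k : 'I_n, i < j -> k = j.+1 :> nat ->
             ~~ order_isomorphic [:: val (pi i); val (pi j); val (pi k)] [:: a; b; c])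
          (avoids pi (Dash1 a b c)).
Proof.
apply: (iffP idP) => [/negP H i j k ij kE | H].
  apply/negP => O; apply: H; apply/existsP; exists i; apply/existsP; exists j.
  by apply/existsP; exists k; rewrite ij kE eqxx.
apply/negP => /existsP[i /existsP[j /existsP[k /and3P[ij /eqP kE]]]].
by apply/negP/H.
Qed.

Lemma avoids_Dash2P (n : nat) (pi : 'S_n) (a b c : nat) :
  reflect (forall i j k : 'I_n, j = i.+1 :> nat -> j < k ->
             ~~ order_isomorphic [:: val (pi i); val (pi j); val (pi k)] [:: a; b; c])
          (avoids pi (Dash2 a b c)).
Proof.
apply: (iffP idP) => [/negP H i j k jE jk | H].
  apply/negP => O; apply: H; apply/existsP; exists i; apply/existsP; exists j.
  by apply/existsP; exists k; rewrite jk jE eqxx.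
apply/negP => /existsP[i /existsP[j /existsP[k /and3P[/eqP jE jk]]]].
by apply/negP/H.
Qed.

Lemma avoids3_Dash1 (R : nat -> nat -> nat -> bool) (n : nat) (pi : 'S_n) (a b c : nat) :
  (forall x y z, order_isomorphic [:: x; y; z] [:: a; b; c] -> R x y z) ->
  avoids3 R pi -> avoids pi (Dash1 a b c).
Proof.
move=> sub /avoids3P H; apply/avoids_Dash1P => i j k ij kE.
apply: contra (H i j k ij _); [exact: sub | by rewrite kE].
Qed.

Lemma avoids3_Dash2 (R : nat -> nat -> nat -> bool) (n : nat) (pi : 'S_n) (a b c : nat) :
  (forall x y z, order_isomorphic [:: x; y; z] [:: a; b; c] -> R x y z) ->
  avoids3 R pi -> avoids pi (Dash2 a b c).
Proof.
move=> sub /avoids3P H; apply/avoids_Dash2P => i j k jE jk.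
apply: contra (H i j k _ jk); [exact: sub | by rewrite jE].
Qed.

Ltac avoids_dashes R H :=
  apply/and5P; split=> //;
  match goal with
  | |- is_true (avoids _ (Dash1 _ _ _)) => apply: avoids3_Dash1 H
  | |- is_true (avoids _ (Dash2 _ _ _)) => apply: avoids3_Dash2 H
  end; move=> x y z; rewrite order_isomorphicE /R; clear; lia.

Lemma avoiders_123_213 (n : nat) :
  avoiders n [:: Dash1 1 2 3; Dash2 1 2 3; Dash1 2 1 3; Dash2 2 1 3] =
  [set pi | avoids3 last_below_two pi].
Proof.
apply/setP => pi; rewrite !inE; apply/idP/idP => [|H].
  case/and5P=> /avoids_Dash1P A _ /avoids_Dash1P B _ _.
  apply/avoids3P => i j k ij jk.
  rewrite /last_below_two; apply/negP => K.
  (* Crossing the level [pi k] gives [pi p < pi k <= pi q], so [pi q] exceeds both [pi i] and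
     [pi p]: an occurrence of 1-23 or 2-13. *)
  have [|p [q [qE jp qk pq]]] := @perm_crossing n pi (pi k) j k jk; first lia.
  have ip : i < p by lia.
  have := A i p q ip qE; have := B i p q ip qE; rewrite !order_isomorphicE /=.
  have := perm_val_neq n pi i p ip; rewrite /=; lia.
avoids_dashes last_below_two H.
Qed.

Lemma avoiders_312_132 (n : nat) :
  avoiders n [:: Dash2 3 1 2; Dash1 3 1 2; Dash2 1 3 2; Dash1 1 3 2] =
  [set pi | avoids3 last_between pi].
Proof.
apply/setP => pi; rewrite !inE; apply/idP/idP => [|H].
  case/and5P=> /avoids_Dash2P A _ /avoids_Dash2P B _ _.
  apply/avoids3P => i j k ij jk.
  rewrite /last_between; apply/negP => K.
  (* Both positions of the adjacent pair precede [k] and their values lie on either side of [pi k]: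
     an occurrence of 13-2 or 31-2. *)
  have [|p [q [qE ip qj pq]]] := @perm_crossing n pi (pi k) i j ij; first lia.
  have qk : q < k by lia.
  have pk : p < k by lia.
  have := A p q k qE qk; have := B p q k qE qk; rewrite !order_isomorphicE /=.
  have := perm_val_neq n pi p k pk; have := perm_val_neq n pi q k qk.
  rewrite /=; lia.
avoids_dashes last_between H.
Qed.

Lemma avoiders_213_132 (n : nat) :
  avoiders n [:: Dash1 2 1 3; Dash2 2 1 3; Dash2 1 3 2; Dash1 1 3 2] =
  [set pi | avoids3 is_213_or_132 pi].
Proof.
apply/setP => pi; rewrite !inE; apply/idP/idP => [|H].
  case/and5P=> /avoids_Dash1P A _ /avoids_Dash2P B _ _.
  apply/avoids3P => i j k ij jk.
  rewrite /is_213_or_132; apply/negP => /orP[] K.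
    (* A classical 213 is tightened to 2-13 at the level of its first value; below, a 132 is
       tightened to 13-2 at the level of its last value. *)
    have [|p [q [qE jp qk pq]]] := @perm_crossing n pi (pi i) j k jk; first lia.
    have ip : i < p by lia.
    have iq : i < q by lia.
    have := A i p q ip qE; rewrite !order_isomorphicE /=.
    have := perm_val_neq n pi i p ip; have := perm_val_neq n pi i q iq.
    rewrite /=; lia.
  have [|p [q [qE ip qj pq]]] := @perm_crossing n pi (pi k) i j ij; first lia.
  have qk : q < k by lia.
  have pk : p < k by lia.
  have := B p q k qE qk; rewrite !order_isomorphicE /=.
  have := perm_val_neq n pi p k pk; have := perm_val_neq n pi q k qk.
  rewrite /=; lia.
avoids_dashes is_213_or_132 H.
Qed.

Lemma avoiders_231_132 (n : nat) :
  avoiders n [:: Dash1 2 3 1; Dash2 2 3 1; Dash1 1 3 2; Dash2 1 3 2] =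
  [set pi | avoids3 is_peak pi].
Proof.
apply/setP => pi; rewrite !inE; apply/idP/idP => [|H].
  case/and5P=> /avoids_Dash1P A _ _ /avoids_Dash2P B _.
  apply/avoids3P => i j k ij jk.
  have ik := ltn_trans ij jk.
  rewrite /is_peak; apply/negP => K.
  (* The lower of the two outer values tells 231, which yields 2-31, from 132, which yields 13-2. *)
  have [lt_ki | lt_ik] := ltnP (pi k) (pi i).
    have [|p [q [qE jp qk pq]]] := @perm_crossing n pi (pi i) j k jk; first lia.
    have ip : i < p by lia.
    have := A i p q ip qE; rewrite !order_isomorphicE /=.
    have := perm_val_neq n pi i p ip; rewrite /=; lia.
  have := perm_val_neq n pi i k ik; rewrite /= => neq_ik.
  have [|p [q [qE ip qj pq]]] := @perm_crossing n pi (pi k) i j ij; first lia.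
  have qk : q < k by lia.
  have := B p q k qE qk; rewrite !order_isomorphicE /=.
  have := perm_val_neq n pi q k qk; rewrite /=; lia.
avoids_dashes is_peak H.
Qed.

(** * Inversion and the fourth set *)

(** Inversion swaps positions and values: the middle position holding the largest value becomes the
    middle value standing at the last position. *)
Lemma avoids_peak_inv (n : nat) (pi : 'S_n) :
  avoids3 is_peak pi^-1%g = avoids3 last_between pi.
Proof.
apply/avoids3P/avoids3P => H i j k ij jk; apply/negP.
  rewrite /last_between => /orP[]/andP[H1 H2].
    have := H _ _ _ H1 H2; rewrite !permK /is_peak; lia.
  have := H _ _ _ H1 H2; rewrite !permK /is_peak; lia.
rewrite /is_peak => /andP[H1 H2].
have [lt_ik | le_ki] := ltnP ((pi^-1)%g i) ((pi^-1)%g k).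
  have := H _ _ _ lt_ik H2; rewrite !permKV /last_between; lia.
have lt_ki : (pi^-1)%g k < (pi^-1)%g i.
  have := perm_val_neq n (pi^-1)%g i k (ltn_trans ij jk); rewrite /=; lia.
have := H _ _ _ lt_ki H1; rewrite !permKV /last_between; lia.
Qed.

Lemma card_avoids_peak (n : nat) :
  #|[set pi : 'S_n | avoids3 is_peak pi]| =
  #|[set pi : 'S_n | avoids3 last_between pi]|.
Proof.
rewrite -(card_imset _ (@invg_inj 'S_n)); apply: eq_card => pi.
rewrite !inE; apply/imsetP/idP => [[s] | H].
  by rewrite inE => H ->; rewrite -avoids_peak_inv invgK.
by exists pi^-1%g; rewrite ?invgK // inE avoids_peak_inv.
Qed.

(** * Counting by the last value *)

(* [bump v] shifts the values [>= v] up by one to make room for the new last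
   value [v]. *)
Definition good_last (R : nat -> nat -> nat -> bool) {n : nat} (s : 'S_n)
    (v : 'I_n.+1) : bool :=
  [forall i : 'I_n, forall j : 'I_n,
     (i < j) ==> ~~ R (bump v (s i)) (bump v (s j)) v].

Lemma good_lastP (R : nat -> nat -> nat -> bool) (n : nat) (s : 'S_n) (v : 'I_n.+1) :
  reflect (forall i j : 'I_n, i < j -> ~~ R (bump v (s i)) (bump v (s j)) v)
          (good_last R s v).
Proof.
apply: (iffP idP) => [H i j ij | H].
  by move/forallP/(_ i)/forallP/(_ j)/implyP: H; apply.
by apply/forallP => i; apply/forallP => j; apply/implyP; apply: H.
Qed.

Definition order_invariant (R : nat -> nat -> nat -> bool) : Prop :=
  forall h a b c : nat, R (bump h a) (bump h b) (bump h c) = R a b c.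

Lemma bump_lt (h a b : nat) : (bump h a < bump h b) = (a < b).
Proof. by rewrite !ltnNge leq_bump2. Qed.

(** A triple of positions either lies inside [s], where [bump v] preserves the order, or ends at the
    new last position. *)
Lemma avoids3_lift_perm (R : nat -> nat -> nat -> bool) (n : nat) (v : 'I_n.+1)
    (s : 'S_n) :
  order_invariant R ->
  avoids3 R (lift_perm ord_max v s) = avoids3 R s && good_last R s v.
Proof.
move=> invR; apply/avoids3P/andP => [H | [/avoids3P Hs /good_lastP Hv] i j k].
  split; [apply/avoids3P => i j k ij jk | apply/good_lastP => i j ij].
    have := H (lift ord_max i) (lift ord_max j) (lift ord_max k).
    by rewrite !lift_perm_lift !lift_max /= invR; apply.
  have := H (lift ord_max i) (lift ord_max j) ord_max.
  rewrite !lift_perm_lift lift_perm_id !lift_max /=; apply=> //.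
case: (unliftP ord_max i) => [i'|] ->; last by have := ltn_ord j; rewrite /=; lia.
case: (unliftP ord_max j) => [j'|] ->; last by have := ltn_ord k; rewrite /=; lia.
case: (unliftP ord_max k) => [k'|] ->.
  rewrite !lift_perm_lift !lift_max /= invR; exact: Hs.
rewrite !lift_perm_lift lift_perm_id !lift_max /= => ij _; exact: Hv.
Qed.

(** Injectivity suffices, since both sides have [(n.+1)!] elements. *)
Lemma lift_perm_bij (n : nat) :
  bijective (fun vs : 'I_n.+1 * 'S_n => lift_perm ord_max vs.1 vs.2).
Proof.
apply: inj_card_bij => [[v s] [w t] /= E|].
  have Ev : v = w by rewrite -(lift_perm_id ord_max v s) E lift_perm_id.
  congr (_, _) => //; apply/permP => i; apply: (@lift_inj _ v).
  by rewrite -(lift_perm_lift ord_max v s) E Ev lift_perm_lift.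
by rewrite card_prod card_ord !card_Sn factS.
Qed.

Lemma card_avoids3 (R : nat -> nat -> nat -> bool) (m : nat) :
  order_invariant R ->
  (forall n (s : 'S_n.+1), avoids3 R s -> #|[set v | good_last R s v]| = 2) ->
  #|[set pi : 'S_m.+1 | avoids3 R pi]| = 2 ^ m.
Proof.
move=> invR two; elim: m => [|m IH].
  apply/eqP; rewrite expn0 eqn_leq card_gt0; apply/andP; split.
    by apply: leq_trans (max_card _) _; rewrite card_Sn.
  apply/set0Pn; exists 1%g; rewrite inE; apply/avoids3P => i j k.
  have := ltn_ord j; have := ltn_ord k; lia.
rewrite expnSr -IH -!sum1_card.
rewrite (reindex _ (onW_bij _ (lift_perm_bij m.+1))) /=.
under eq_bigl => vs do rewrite inE avoids3_lift_perm //.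
(* Indicators turn the count into a double sum; after the exchange, the inner sum counts the good
   last values of a fixed [s]. *)
rewrite big_mkcond -(pair_bigA _ (fun v s => if avoids3 R s && good_last R s v then 1 else 0)).
rewrite exchange_big /= big_distrl [RHS]big_mkcond; apply: eq_bigr => s _.
rewrite inE; case: ifP => Rs; last by rewrite big1.
by rewrite -big_mkcond sum1dep_card two.
Qed.

Lemma order_invariant_last_below_two : order_invariant last_below_two.
Proof. by move=> h a b c; rewrite /last_below_two !bump_lt. Qed.

Lemma order_invariant_last_between : order_invariant last_between.
Proof. by move=> h a b c; rewrite /last_between !bump_lt. Qed.

Lemma order_invariant_is_213_or_132 : order_invariant is_213_or_132.
Proof. by move=> h a b c; rewrite /is_213_or_132 !bump_lt. Qed.

(** * The two good last values for each relation *)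

Lemma bump_cases (h a : nat) : (a < h /\ bump h a = a) \/ (h <= a /\ bump h a = a.+1).
Proof. rewrite /bump; case: leqP; lia. Qed.

Lemma perm_position (n : nat) (s : 'S_n) (v : nat) :
  v < n -> exists i : 'I_n, val (s i) = v.
Proof. by move=> lt_vn; exists ((s^-1)%g (Ordinal lt_vn)); rewrite permKV. Qed.

Lemma card_good_last2 (R : nat -> nat -> nat -> bool) (n : nat) (s : 'S_n.+1) (w : nat) :
  0 < w <= n.+1 ->
  (forall v : 'I_n.+2, good_last R s v = (v == 0 :> nat) || (v == w :> nat)) ->
  #|[set v | good_last R s v]| = 2.
Proof.
move=> /andP[w_gt0 w_le] H.
suff -> : [set v | good_last R s v] = [set ord0; inord w].
  by rewrite cards2 -val_eqE /= inordK // ltn_eqF.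
by apply/setP => v; rewrite !inE H -!val_eqE /= inordK.
Qed.

Lemma perm_eq_val (n : nat) (s : 'S_n) (i j : 'I_n) :
  val (s i) <> val (s j) -> i < j \/ j < i.
Proof.
move=> H; case: (ltngtP i j) => [||/val_inj E]; [by left | by right |].
by case: H; rewrite E.
Qed.

(** If [v] is at least 2, the values 0 and 1 of [s] both stay below it; if [v] is 0 or 1, at most
    one value does. *)
Lemma good_last_below_two (n : nat) (s : 'S_n.+1) (v : 'I_n.+2) :
  good_last last_below_two s v = (v == 0 :> nat) || (v == 1 :> nat).
Proof.
apply/good_lastP/idP => [H | Hv i j ij].
  apply/negPn/negP => Hv; have lt_v := ltn_ord v.
  have [|i Ei] := @perm_position _ s 0; first lia.
  have [|j Ej] := @perm_position _ s 1; first lia.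
  have := @perm_eq_val _ s i j; rewrite Ei Ej => P.
  have bi := bump_cases v (s i); have bj := bump_cases v (s j).
  rewrite /= in Ei Ej.
  (* The order of the two positions is immaterial: [last_below_two] is symmetric in its first two
     arguments. *)
  by have {P} [/H|/H] := P ltac:(lia); rewrite /last_below_two; lia.
rewrite /last_below_two; have := @perm_val_neq _ s i j ij.
have := bump_cases v (s i); have := bump_cases v (s j); rewrite /=; lia.
Qed.

(** Any other [v] lies strictly between the value 0 and the value [n], which is shifted to
    [n.+1]. *)
Lemma good_last_between (n : nat) (s : 'S_n.+1) (v : 'I_n.+2) :
  good_last last_between s v = (v == 0 :> nat) || (v == n.+1 :> nat).
Proof.
apply/good_lastP/idP => [H | Hv i j ij].
  apply/negPn/negP => Hv; have lt_v := ltn_ord v.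
  have [|i Ei] := @perm_position _ s 0; first lia.
  have [|j Ej] := @perm_position _ s n; first lia.
  have := @perm_eq_val _ s i j; rewrite Ei Ej => P.
  have bi := bump_cases v (s i); have bj := bump_cases v (s j).
  rewrite /= in Ei Ej.
  by have {P} [/H|/H] := P ltac:(lia); rewrite /last_between; lia.
rewrite /last_between; have := ltn_ord (s i); have := ltn_ord (s j).
have := bump_cases v (s i); have := bump_cases v (s j); rewrite /=; lia.
Qed.

Lemma good_last_213_132 (n : nat) (s : 'S_n.+1) (v : 'I_n.+2) :
  avoids3 is_213_or_132 s ->
  good_last is_213_or_132 s v = (v == 0 :> nat) || (v == (s ord_max).+1 :> nat).
Proof.
move=> /avoids3P Hs; apply/good_lastP/idP => [H | Hv i j ij].
  apply/negPn/negP => Hv; have lt_v := ltn_ord v.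
  have lt_last (i : 'I_n.+1) : val (s i) <> val (s ord_max) -> i < (ord_max : 'I_n.+1).
    by case/perm_eq_val => //; have := ltn_ord i; rewrite /=; lia.
  have bm := bump_cases v (s ord_max).
  (* Let m be the last value of [s]. If [0 < v <= m], the values 0, m + 1, v form 132; if
     [v > m + 1], the values m + 1, m, v form 213. *)
  have [le_v | gt_v] := leqP v (s ord_max).
    have [|i Ei] := @perm_position _ s 0; first lia.
    have bi := bump_cases v (s i); rewrite /= in Ei.
    have /lt_last/H : val (s i) <> val (s ord_max) by rewrite /=; lia.
    by rewrite /is_213_or_132; lia.
  have [|i Ei] := @perm_position _ s (s ord_max).+1; first lia.
  have bi := bump_cases v (s i); rewrite /= in Ei.
  have /lt_last/H : val (s i) <> val (s ord_max) by rewrite /=; lia.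
  by rewrite /is_213_or_132; lia.
rewrite /is_213_or_132; have := @perm_val_neq _ s i j ij.
have := bump_cases v (s i); have := bump_cases v (s j); rewrite /=.
(* For [v] = m + 1 and [j] before the end, comparing with [v] amounts to comparing with m, so [Hs]
   applies to [i], [j] and the last position of [s]. *)
have [lt_j | ] := ltnP j (ord_max : 'I_n.+1).
  have := Hs i j ord_max ij lt_j; rewrite /is_213_or_132.
  have := @perm_val_neq _ s i ord_max (ltn_trans ij lt_j).
  have := @perm_val_neq _ s j ord_max lt_j; rewrite /=; lia.
move=> ge_j; have -> : j = ord_max by apply/val_inj; have := ltn_ord j; move: ge_j => /=; lia.
lia.
Qed.

Theorem mainTheorem3 (n : nat) (hn : 1 <= n) :
  [/\ #|avoiders n [:: Dash1 1 2 3; Dash2 1 2 3; Dash1 2 1 3; Dash2 2 1 3]|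
        = 2 ^ (n - 1),
      #|avoiders n [:: Dash2 3 1 2; Dash1 3 1 2; Dash2 1 3 2; Dash1 1 3 2]|
        = 2 ^ (n - 1),
      #|avoiders n [:: Dash1 2 1 3; Dash2 2 1 3; Dash2 1 3 2; Dash1 1 3 2]|
        = 2 ^ (n - 1)
    & #|avoiders n [:: Dash1 2 3 1; Dash2 2 3 1; Dash1 1 3 2; Dash2 1 3 2]|
        = 2 ^ (n - 1)].
Proof.
case: n hn => // m _; rewrite subn1 /=.
have card_between : #|[set pi : 'S_m.+1 | avoids3 last_between pi]| = 2 ^ m.
  apply: (card_avoids3 _ _ order_invariant_last_between) => n s _.
  by apply: (@card_good_last2 _ _ _ n.+1) => [|v]; rewrite ?leqnn ?good_last_between.
split.
- rewrite avoiders_123_213; apply: (card_avoids3 _ _ order_invariant_last_below_two).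
  by move=> n s _; apply: (@card_good_last2 _ _ _ 1) => // v; apply: good_last_below_two.
- by rewrite avoiders_312_132.
- rewrite avoiders_213_132; apply: (card_avoids3 _ _ order_invariant_is_213_or_132).
  move=> n s Hs; apply: (@card_good_last2 _ _ _ (s ord_max).+1) => [|v].
    by rewrite /= ltn_ord.
  exact: good_last_213_132.
- by rewrite avoiders_231_132 card_avoids_peak.
Qed.
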